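(* Let $\Omega=\Omega_t\times\Omega_s$ be decomposed into time and space, in dimension $n=1+3$, and let $F=\sum_{p=0}^4 f^p$ and $G=\sum_{p=0}^4 g^p$ be general fields on $\Omega$, with $f^p=f^p_t+f^p_s$ and $g^p=g^p_t+g^p_s$ the decompositions into time-like and space-like components. Then the general conservation law for the pair $\{F,G\}$, that is, the pair of differential equations $$\mathrm{d}_\nabla F=0,\qquad \star\mathrm{d}_\nabla\star F=\star\star G,$$ is given by (i.e. is equivalent to) the system $$ \begin{bmatrix} \mathrm{d}t\wedge\partial_t &0&0&0&0& \mathrm{d}^s_\nabla &0&0\\ 0&\star(\mathrm{d}t\wedge\partial_t)\star &0&0& \mathrm{d}^s_\nabla &0&0&0\\ 0&0&\mathrm{d}t\wedge\partial_t &0&0& -\star\mathrm{d}^s_\nabla\star &0& \mathrm{d}^s_\nabla\\ 0&0&0&\star(\mathrm{d}t\wedge\partial_t)\star & \star\mathrm{d}^s_\nabla\star &0& \mathrm{d}^s_\nabla &0\\ 0&\star\mathrm{d}^s_\nabla\star &0& \mathrm{d}^s_\nabla & \mathrm{d}t\wedge\partial_t &0&0&0\\ -\star\mathrm{d}^s_\nabla\star &0& \mathrm{d}^s_\nabla &0&0& -\star(\mathrm{d}t\wedge\partial_t)\star &0&0\\ 0&0&0&\star\mathrm{d}^s_\nabla\star &0&0& \mathrm{d}t\wedge\partial_t &0\\ 0&0&-\star\mathrm{d}^s_\nabla\star &0&0&0&0& -\star(\mathrm{d}t\wedge\partial_t)\star \end{bmatrix} \begin{bmatrix} f^3_s\\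 f^4_t\\ f^1_s\\ f^2_t\\ f^2_s\\ f^3_t\\ f^0\\ f^1_t\end{bmatrix} = \begin{bmatrix} g^4_t\\ g^3_s\\ g^2_t\\ g^1_s\\ g^3_t\\ g^2_s\\ g^1_t\\ g^0\end{bmatrix}. $$
   Context: Setting: $\Omega$ is an $n$-dimensional smooth oriented Minkowski manifold with metric tensor of signature $(-,+,\dots,+)$ (it may be assumed topologically trivial), here with $n=4$, decomposed into space and time as $\Omega=\Omega_t\times\Omega_s$. Here $\Omega_s$ is the space-like part, a 3-dimensional Riemannian manifold with metric $g_s$, and $\Omega_t$ is the time-like part, with time coordinate $t$; the metric is $-\mathrm{d}t^2+g_s$. $E$ is a smooth real vector bundle over $\Omega$ equipped with a metric, $E^*$ is its dual, and $\mathrm{End}(E)\cong E\otimes E^*$ is its endomorphism bundle. $\Gamma(\cdot)$ denotes the sections of a bundle. The maps $\flat:\Gamma(E)\to\Gamma(E^* )$ and $\sharp:\Gamma(E^* )\to\Gamma(E)$ are the flat and sharp maps of the metric on $E$. General field: a section of $\bigoplus_{p=0}^n\bigwedge^pT^*\Omega$, of $\bigoplus_{p=0}^n(E^p\otimes\bigwedge^pT^*\Omega)$ with $E^p$ either $E$ or $E^*$, or of $\bigoplus_{p=0}^n(\mathrm{End}(E)\otimes\bigwedge^pT^*\Omega)$. Its degree-$p$ component is written $f^p$ (respectively $g^p$), and ''$p$-form'' means an ordinary, $E$-valued, $E^*$-valued or $\mathrm{End}(E)$-valued $p$-form. Hodge operator: on ordinary forms $\star$ is the Hodge operator of the metric on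 $\Omega$. It is extended by $s\otimes\sigma\mapsto\flat s\otimes\star\sigma$ on $E$-valued forms, by $s\otimes\sigma\mapsto\sharp s\otimes\star\sigma$ on $E^*$-valued forms, and by $S\otimes\sigma\mapsto S\otimes\star\sigma$ on $\mathrm{End}(E)$-valued forms. It satisfies $\star\star=(-1)^{p(n-p)+1}$ on $p$-forms. Derivative: $\nabla$ is a connection and $\mathrm{d}_\nabla$ is the covariant exterior derivative; it reduces to the exterior derivative $\mathrm{d}$ if the connection is trivial (in particular for ordinary forms). It is decomposed as $\mathrm{d}_\nabla=\mathrm{d}t\wedge\partial_t+\mathrm{d}^s_\nabla$, where $\mathrm{d}t\wedge\partial_t$ is its time-like part and $\mathrm{d}^s_\nabla$ its space-like part. Decomposition of forms: for $p>0$, each $p$-form is uniquely $f^p=f^p_t+f^p_s$, where $f^p_s$ involves only space-like components (no factor $\mathrm{d}t$) and $f^p_t$ contains the remaining components, those with a factor $\mathrm{d}t$. For $p=4$ one has $f^4=f^4_t$, and $0$-forms are not split. The same notation is used for $g^p$. General conservation law: the differential equations $\mathrm{d}_\nabla F=0$ and $\star\mathrm{d}_\nabla\star F=\star\star G$ on $\Omega$ are said to form the general conservation law for the pair $\{F,G\}$ of general fields if the equations are derived from a real valued action (they arise by requiring the variation of the action to vanish). The type of action considered is $\mathcal A^p=\frac12\int_\Omega\mathrm{tr}(f^p\wedge\star f^p)+\int_\Omega\mathrm{tr}(a^{p-1}\wedge\star g^{p+1})$, as printed in the paper, where $a^{p-1}$ is the potential, which is varied, $\mathrm{tr}$ is the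 trace $V\otimes V^*\to\mathbb R$, $v\otimes\nu\mapsto\nu(v)$, and the wedge product acts on bundle-valued forms by $(s\otimes\sigma)\wedge(s'\otimes\sigma')=(s\otimes s')\otimes(\sigma\wedge\sigma')$ for $E$- and $E^*$-valued forms and $(S\otimes\sigma)\wedge(S'\otimes\sigma')=SS'\otimes(\sigma\wedge\sigma')$ for $\mathrm{End}(E)$-valued forms.
   Formalization: The system alone does not imply the law (F = x¹, G = dx¹ on flat Minkowski space solves it with dF ≠ 0), so the formal theorem states: the law holds if and only if d_∇F = 0 and the matrix system holds. *)

(* Defs.v *)
From HB Require Import structures.
From mathcomp Require Import all_boot all_order all_algebra.
From mathcomp Require Import all_classical all_reals all_analysis.
Set Implicit Arguments.
Unset Strict Implicit.
Unset Printing Implicit Defensive.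
Import Order.TTheory GRing.Theory Num.Theory.
Import numFieldNormedType.Exports.
Local Open Scope classical_set_scope.
Local Open Scope ring_scope.

(** * Smooth maps between coordinate domains *)

Fixpoint Cn (R : realType) (m : nat) (V : normedModType R) (n : nat)
    (U : set 'rV[R]_m) (f : 'rV[R]_m -> V) : Prop :=
  (forall x, U x -> {for x, continuous f}) /\
  (if n is n'.+1 then
     forall i : 'I_m, (forall x, U x -> derivable f x (delta_mx 0 i)) /\
                      Cn n' U (fun x => 'D_(delta_mx 0 i) f x)
   else True).

Definition smooth (R : realType) (m : nat) (V : normedModType R)
    (U : set 'rV[R]_m) (f : 'rV[R]_m -> V) : Prop := forall n, Cn n U f.

(* Column convention: the (i, j) entry is the j-th partial derivative of the
   i-th component of f (the transpose of the library's [jacobian]). *)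
Definition jac (R : realType) (m : nat) (f : 'rV[R]_m -> 'rV[R]_m)
    (x : 'rV[R]_m) : 'M[R]_m :=
  \matrix_(i, j) ('D_(delta_mx 0 j) f x) 0 i.

(** * The space-time [time x space] with metric [- dt^2 + g_s] *)

Record oriented_manifold (R : realType) (m : nat) := OrientedManifold {
  carrier :> topologicalType;
  carrier_hausdorff : hausdorff_space carrier;
  carrier_second_countable : @second_countable carrier;
  chart : Type;
  cdom : chart -> set carrier;
  ccoord : chart -> carrier -> 'rV[R]_m;
  cpoint : chart -> 'rV[R]_m -> carrier;
  cdom_open : forall c, open (cdom c);
  cdom_cover : forall p, exists c, cdom c p;
  crange_open : forall c, open (ccoord c @` cdom c);
  ccoordK : forall c p, cdom c p -> cpoint c (ccoord c p) = p;
  ccoord_continuous : forall c p, cdom c p -> {for p, continuous (ccoord c)};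
  cpoint_continuous : forall c x, (ccoord c @` cdom c) x ->
    {for x, continuous (cpoint c)};
  ctrans_smooth : forall c d,
    smooth [set x | (ccoord c @` cdom c) x /\ cdom d (cpoint c x)]
           (ccoord d \o cpoint c);
  ctrans_oriented : forall c d x,
    (ccoord c @` cdom c) x -> cdom d (cpoint c x) ->
    0 < \det (jac (ccoord d \o cpoint c) x)
}.

Record riemannian_metric (R : realType) (m : nat)
    (S : oriented_manifold R m) := RiemannianMetric {
  gs : chart S -> 'rV[R]_m -> 'M[R]_m;
  gs_smooth : forall c, smooth (@ccoord _ _ S c @` cdom c) (gs c);
  gs_sym : forall c x, (@ccoord _ _ S c @` cdom c) x -> (gs c x)^T = gs c x;
  gs_pos : forall c x, (@ccoord _ _ S c @` cdom c) x ->
    forall v : 'rV[R]_m, v != 0 -> 0 < (v *m gs c x *m v^T) 0 0;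
  gs_trans : forall c d x,
    (@ccoord _ _ S c @` cdom c) x -> cdom d (cpoint c x) ->
    let phi := @ccoord _ _ S d \o cpoint c in
    gs c x = (jac phi x)^T *m gs d (phi x) *m jac phi x
}.

Record spacetime (R : realType) := Spacetime {
  time : set R;
  time_open : open time;
  time_interval : is_interval time;
  time_nonempty : time !=set0;
  space : oriented_manifold R 3;
  space_metric : riemannian_metric space
}.

(** * Vector bundles over space-time *)

(* Space-time coordinates are (t, x1, x2, x3), where x is given by a chart of
   space; the index 0 is the time. *)
Definition coords (R : realType) (Om : spacetime R) (c : chart (space Om))
    (p : R * space Om) : 'rV[R]_4 :=
  row_mx (const_mx p.1 : 'rV[R]_1) (ccoord c p.2).

Definition space_part (R : realType) (x : 'rV[R]_4) : 'rV[R]_3 :=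
  rsubmx (x : 'rV[R]_(1 + 3)).

Definition event (R : realType) (Om : spacetime R) (c : chart (space Om))
    (x : 'rV[R]_4) : R * space Om :=
  (x 0 ord0, cpoint c (space_part x)).

(* A vector bundle is given by an atlas of local frames: [frame] is the index
   set, the k-th frame trivializes the bundle over [fdom k], on which the
   coordinates of the chart [fchart k] are used.  The transition matrix
   [ftrans k l], a function of the coordinates of k, sends components in the
   frame l to components in the frame k.  All the other objects below
   (metric, connection, fields) are given in the classical way, by their
   components in each frame, as functions of the coordinates, together with
   their transformation law. *)
Record vector_bundle (R : realType) (Om : spacetime R) (N : nat) :=
  VectorBundle {
  frame : Type;
  fdom : frame -> set (R * space Om);
  fchart : frame -> chart (space Om);
  fdom_open : forall k, open (fdom k);
  fdom_sub : forall k p, fdom k p -> time Om p.1 /\ cdom (fchart k) p.2;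
  fdom_cover : forall p, time Om p.1 -> exists k, fdom k p;
  ftrans : frame -> frame -> 'rV[R]_4 -> 'M[R]_N;
  region := fun k => coords (fchart k) @` fdom k;
  overlap := fun k l => [set x | region k x /\ fdom l (event (fchart k) x)];
  change := fun k l (x : 'rV[R]_4) => coords (fchart l) (event (fchart k) x);
  ftrans_smooth : forall k l, smooth (overlap k l) (ftrans k l);
  ftrans_unit : forall k l x, overlap k l x -> ftrans k l x \in unitmx;
  ftrans_cocycle : forall k l m x, overlap k l x -> overlap k m x ->
    ftrans k m x = ftrans k l x *m ftrans l m (change k l x)
}.

(* A metric on the fibres; only nondegeneracy is required, which covers both
   the positive definite and the indefinite case. *)
Record bundle_metric (R : realType) (Om : spacetime R) (N : nat)
    (E : vector_bundle Om N) := BundleMetric {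
  bm : frame E -> 'rV[R]_4 -> 'M[R]_N;
  bm_smooth : forall k, smooth (@region _ _ _ E k) (bm k);
  bm_sym : forall k x, region k x -> (bm k x)^T = bm k x;
  bm_nondegenerate : forall k x, region k x -> bm k x \in unitmx;
  bm_trans : forall k l x, overlap k l x ->
    bm l (change k l x) = (ftrans k l x)^T *m bm k x *m ftrans k l x
}.

(* In the frame k, the covariant derivative of a section s of E along the i-th
   coordinate is ['D_i s + conn k i *m s]. *)
Record connection (R : realType) (Om : spacetime R) (N : nat)
    (E : vector_bundle Om N) := Connection {
  conn : frame E -> 'I_4 -> 'rV[R]_4 -> 'M[R]_N;
  conn_smooth : forall k i, smooth (@region _ _ _ E k) (conn k i);
  conn_trans : forall k l x, overlap k l x -> forall i,
    'D_(delta_mx 0 i) (ftrans k l) x + conn k i x *m ftrans k l x =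
    ftrans k l x *m
      \sum_(a < 4) jac (@change _ _ _ E k l) x a i *: conn l a (change k l x)
}.

(** * Values of forms: R, E or E^*, End(E) *)

(* A [Mixed] value lies in the direct sum of E (columns) and E^* (rows); a
   form with values in E, or in E^*, has only the corresponding component.
   E and E^* may thus be chosen independently in each degree of each field, and
   equations between forms of mixed type are read in the direct sum. *)
Inductive kind := Ordinary | Mixed | Endo.

Definition value (R : realType) (N : nat) (K : kind) : normedModType R :=
  match K with
  | Ordinary => R^o
  | Mixed => ('cV[R]_N * 'rV[R]_N)%type
  | Endo => 'M[R]_N
  end.

Definition value_trans (R : realType) (N : nat) (K : kind) (T : 'M[R]_N) :
    value R N K -> value R N K :=
  match K with
  | Ordinary => fun v => v
  | Mixed => fun v => (T *m v.1, v.2 *m invmx T)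
  | Endo => fun v => T *m v *m invmx T
  end.

Definition value_conn (R : realType) (N : nat) (K : kind) (A : 'M[R]_N) :
    value R N K -> value R N K :=
  match K with
  | Ordinary => fun=> 0
  | Mixed => fun v => (A *m v.1, - (v.2 *m A))
  | Endo => fun v => A *m v - v *m A
  end.

(* flat and sharp of the metric h for E- and E^*-values *)
Definition value_star (R : realType) (N : nat) (K : kind) (h : 'M[R]_N) :
    value R N K -> value R N K :=
  match K with
  | Ordinary => fun v => v
  | Mixed => fun v => (invmx h *m v.2^T, (h *m v.1)^T)
  | Endo => fun v => v
  end.

(** * General fields *)

(* A general field is given in each frame by the coefficients f_I of
   f = \sum_I f_I dx^I, where dx^I is the wedge product in increasing order of
   the dx^i for i in I. *)
Definition gform (R : realType) (Om : spacetime R) (N : nat)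
    (E : vector_bundle Om N) (K : kind) : Type :=
  frame E -> 'rV[R]_4 -> {set 'I_4} -> value R N K.

Definition minor (R : realType) (M : 'M[R]_4) (I J : {set 'I_4}) : R :=
  \det (\matrix_(a < #|I|, b < #|I|)
          M (nth ord0 (enum I) a) (nth ord0 (enum J) b)).

(* dx^I /\ dx^J = wsign I J dx^(I u J) for disjoint I and J *)
Definition wsign (R : realType) (I J : {set 'I_4}) : R :=
  (-1) ^+ #|[set p : 'I_4 * 'I_4 | [&& p.1 \in I, p.2 \in J & (p.2 < p.1)%N]]|.

Definition form_eq (R : realType) (Om : spacetime R) (N : nat)
    (E : vector_bundle Om N) (K : kind) (F G : gform E K) : Prop :=
  forall k x, region k x -> forall I, F k x I = G k x I.

Record general_field (R : realType) (Om : spacetime R) (N : nat)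
    (E : vector_bundle Om N) (K : kind) (F : gform E K) : Prop := GeneralField {
  gfield_smooth : forall k I, smooth (@region _ _ _ E k) (fun x => F k x I);
  gfield_trans : forall k l x, overlap k l x -> forall I,
    F k x I =
    \sum_(J : {set 'I_4} | #|J| == #|I|)
       minor (jac (@change _ _ _ E k l) x) J I *:
         value_trans (ftrans k l x) (F l (change k l x) J);
  gfield_pure :
    match K return gform E K -> Prop with
    | Mixed => fun F0 => forall p : nat,
        (forall k x (I : {set 'I_4}),
           region k x -> #|I| = p -> (F0 k x I).2 = 0) \/
        (forall k x (I : {set 'I_4}),
           region k x -> #|I| = p -> (F0 k x I).1 = 0)
    | _ => fun=> True
    end F
}.

Definition deg (R : realType) (Om : spacetime R) (N : nat)
    (E : vector_bundle Om N) (K : kind) (p : nat) (F : gform E K) : gform E K :=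
  fun k x I => if #|I| == p then F k x I else 0.

Definition tpart (R : realType) (Om : spacetime R) (N : nat)
    (E : vector_bundle Om N) (K : kind) (F : gform E K) : gform E K :=
  fun k x I => if ord0 \in I then F k x I else 0.

Definition spart (R : realType) (Om : spacetime R) (N : nat)
    (E : vector_bundle Om N) (K : kind) (F : gform E K) : gform E K :=
  fun k x I => if ord0 \in I then 0 else F k x I.

(** * Hodge operator and covariant exterior derivative *)

Definition metric4 (R : realType) (Om : spacetime R) (c : chart (space Om))
    (x : 'rV[R]_4) : 'M[R]_4 :=
  block_mx (- 1%:M : 'M[R]_1) 0 0 (gs (space_metric Om) c (space_part x)).

(* From a /\ star b = <a, b> vol, with vol = sqrt |det g| dt dx1 dx2 dx3:
   star dx^I = \sum_J sqrt |det g| wsign(J^c, J) <dx^I, dx^(J^c)> dx^J. *)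
Definition star (R : realType) (Om : spacetime R) (N : nat)
    (E : vector_bundle Om N) (h : bundle_metric E) (K : kind)
    (F : gform E K) : gform E K :=
  fun k x J =>
    let g := metric4 (fchart k) x in
    (Num.sqrt `|\det g| * wsign R (~: J) J) *:
      value_star (bm h k x)
        (\sum_(I : {set 'I_4} | #|I| == #|~: J|)
            minor (invmx g) I (~: J) *: F k x I).

(* dx^i /\ nabla_i F *)
Definition dwedge (R : realType) (Om : spacetime R) (N : nat)
    (E : vector_bundle Om N) (nabla : connection E) (K : kind) (i : 'I_4)
    (F : gform E K) : gform E K :=
  fun k x I =>
    if i \in I then
      wsign R [set i]%SET (I :\ i)%SET *:
        ('D_(delta_mx 0 i) (fun y => F k y (I :\ i)%SET) x +
         value_conn (conn nabla k i x) (F k x (I :\ i)%SET))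
    else 0.

Definition dcov (R : realType) (Om : spacetime R) (N : nat)
    (E : vector_bundle Om N) (nabla : connection E) (K : kind)
    (F : gform E K) : gform E K :=
  \sum_(i < 4) dwedge nabla i F.

(* d_nabla = dt /\ partial_t + d^s_nabla; the time-like part is taken with the
   time component of the connection. *)
Definition dtime (R : realType) (Om : spacetime R) (N : nat)
    (E : vector_bundle Om N) (nabla : connection E) (K : kind)
    (F : gform E K) : gform E K :=
  dwedge nabla ord0 F.

Definition dspace (R : realType) (Om : spacetime R) (N : nat)
    (E : vector_bundle Om N) (nabla : connection E) (K : kind)
    (F : gform E K) : gform E K :=
  \sum_(i < 4 | i != ord0) dwedge nabla i F.

(** * The conservation law and the system *)

Definition conservation_law (R : realType) (Om : spacetime R) (N : nat)
    (E : vector_bundle Om N) (h : bundle_metric E) (nabla : connection E)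
    (K : kind) (F G : gform E K) : Prop :=
  form_eq (dcov nabla F) 0 /\
  form_eq (star h (dcov nabla (star h F))) (star h (star h G)).

Definition system_matrix (R : realType) (Om : spacetime R) (N : nat)
    (E : vector_bundle Om N) (h : bundle_metric E) (nabla : connection E)
    (K : kind) : seq (seq (gform E K -> gform E K)) :=
  let o := fun F => 0 in
  let T := fun F => dtime nabla F in
  let D := fun F => dspace nabla F in
  let sTs := fun F => star h (dtime nabla (star h F)) in
  let sDs := fun F => star h (dspace nabla (star h F)) in
  let nsTs := fun F => - sTs F in
  let nsDs := fun F => - sDs F in
  [:: [:: T;    o;   o;    o;   o;   D;    o; o];
      [:: o;    sTs; o;    o;   D;   o;    o; o];
      [:: o;    o;   T;    o;   o;   nsDs; o; D];
      [:: o;    o;   o;    sTs; sDs; o;    D; o];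
      [:: o;    sDs; o;    D;   T;   o;    o; o];
      [:: nsDs; o;   D;    o;   o;   nsTs; o; o];
      [:: o;    o;   o;    sDs; o;   o;    T; o];
      [:: o;    o;   nsDs; o;   o;   o;    o; nsTs]].

Definition unknowns (R : realType) (Om : spacetime R) (N : nat)
    (E : vector_bundle Om N) (K : kind) (F : gform E K) : seq (gform E K) :=
  [:: spart (deg 3 F); tpart (deg 4 F); spart (deg 1 F); tpart (deg 2 F);
      spart (deg 2 F); tpart (deg 3 F); deg 0 F; tpart (deg 1 F)].

Definition sources (R : realType) (Om : spacetime R) (N : nat)
    (E : vector_bundle Om N) (K : kind) (G : gform E K) : seq (gform E K) :=
  [:: tpart (deg 4 G); spart (deg 3 G); tpart (deg 2 G); spart (deg 1 G);
      tpart (deg 3 G); spart (deg 2 G); tpart (deg 1 G); deg 0 G].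

(* Each row adds a component of d_nabla F and, up to the sign of star star, of
   star d_nabla star F.  Hence the system alone does not imply d_nabla F = 0:
   for ordinary forms on Minkowski space it holds for F = x1, G = dx1. *)
Definition matrix_system (R : realType) (Om : spacetime R) (N : nat)
    (E : vector_bundle Om N) (h : bundle_metric E) (nabla : connection E)
    (K : kind) (F G : gform E K) : Prop :=
  forall i : 'I_8,
    form_eq
      (\sum_(j < 8) (nth id (nth [::] (system_matrix h nabla K) i) j)
                      (nth 0 (unknowns F) j))
      (nth 0 (sources G) i).

(* Main.v *)
Require Import Defs.
From mathcomp Require Import all_boot all_order all_algebra.
From mathcomp Require Import all_classical all_reals all_analysis.
From mathcomp Require Import fingroup perm zify ring lra.

(* The metric -dt^2 + g_s is block diagonal, so the Hodge star sends forms of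
   degree a with (without) a factor dt to forms of degree 4 - a without (with)
   one.  Sorting the terms of the p-form equation
     d_nabla F + (-1)^(p+1) star d_nabla star F = G
   by degree and by the presence of dt, and dropping those that vanish for
   degree reasons, gives exactly the eight rows of the system.  As
   star star = (-1)^(p+1) on p-forms, this equation is the second conservation
   law once d_nabla F = 0.  The sign of star star follows from the Laplace
   expansion of det g^-1 along complementary sets of rows, and det g_s > 0. *)

Set Implicit Arguments.
Unset Strict Implicit.
Unset Printing Implicit Defensive.
Import Order.TTheory GRing.Theory Num.Theory.
Local Open Scope ring_scope.

(* Permuting the nodes of a Vandermonde determinant multiplies it by the sign of
   the permutation, while the signs of its factors count the inversions. *)
Lemma odd_perm_inversions n (s : 'S_n) :
  odd_perm s = odd #|[set p : 'I_n * 'I_n | (p.1 < p.2)%N && (s p.2 < s p.1)%N]%SET|.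
Proof.
pose V (a : 'I_n -> 'I_n) : int :=
  \det (Vandermonde n (\row_j (a j : nat)%:R : 'rV[int]_n)).
have VE a : V a = \prod_(i < n) \prod_(j < n | (i < j)%N) ((a j)%:R - (a i)%:R).
  rewrite /V det_Vandermonde; apply: eq_bigr => i _.
  by apply: eq_bigr => j _; rewrite !mxE.
have Vs : V s = V id * (-1) ^+ s.
  rewrite /V -odd_permV -det_perm -det_mulmx -col_permE; congr (\det _).
  by apply/matrixP => i j; rewrite !mxE.
have sgV a : injective a -> Num.sg (V a) = (-1) ^+
    #|[set p : 'I_n * 'I_n | (p.1 < p.2)%N && (a p.2 < a p.1)%N]%SET|.
  move=> a_inj; rewrite VE pair_big_dep /= (big_morph _ (@sgrM _) (@sgr1 _)).
  rewrite -prodr_const big_mkcond [RHS]big_mkcond /=.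
  apply: eq_bigr => -[i j] _; rewrite inE /=; case: (ltnP i j) => //= ij.
  case: (ltngtP (a j) (a i)) => aji.
  - by rewrite ltr0_sg // subr_lt0 ltr_nat.
  - by rewrite gtr0_sg // subr_gt0 ltr_nat.
  by move: ij; rewrite (a_inj _ _ (val_inj aji)) ltnn.
have := congr1 Num.sg Vs; rewrite sgrM !sgV //; last exact: perm_inj.
have -> : [set p : 'I_n * 'I_n | (p.1 < p.2)%N && (p.2 < p.1)%N]%SET = finset.set0.
  by apply/setP => p; rewrite !inE; apply/negP => /andP[]; lia.
rewrite cards0 expr0 mul1r -signr_odd.
by case: (odd _); case: (s : bool) => //.
Qed.

(** * Laplace expansion along a set of rows *)

Definition submatrix_det (R : comNzRingType) n (d : 'I_n) (A : 'M[R]_n)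
    (I J : {set 'I_n}) :=
  \det (\matrix_(a < #|I|, b < #|I|) A (nth d (enum I) a) (nth d (enum J) b)).

(** Entries indexed by [nat] let the dimension [#|I|] be replaced by [p] without casts. *)
Lemma det_dim (R : comNzRingType) m n (f : nat -> nat -> R) : m = n ->
  \det (\matrix_(a < m, b < m) f a b) = \det (\matrix_(a < n, b < n) f a b).
Proof. by move->. Qed.

Lemma nth_enum_ltn n (d : 'I_n) (J : {set 'I_n}) (a b : nat) :
  (a < b < #|J|)%N -> (nth d (enum J) a < nth d (enum J) b)%N.
Proof.
move=> /andP[ab bJ].
have J_sorted : sorted (relpre val ltn) (enum J).
  rewrite {1}/enum_mem -enumT; apply: sorted_filter.
    by move=> x y z; apply: ltn_trans.
  by rewrite -sorted_map val_enum_ord iota_ltn_sorted.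
apply: (sorted_ltn_nth _ d J_sorted) => //; rewrite ?inE -?cardE //.
  by move=> x y z; apply: ltn_trans.
exact: ltn_trans bJ.
Qed.

(** The product is the determinant of a block diagonal matrix, in whose expansion any permutation
    mixing the two blocks meets a zero entry. *)
Lemma det_blocks_sum (R : comNzRingType) p q (M : 'M[R]_(p + q)) :
  \det (ulsubmx M) * \det (drsubmx M) =
  \sum_(s : 'S_(p + q) | [forall i : 'I_(p + q), (i < p)%N == (s i < p)%N])
     (-1) ^+ s * \prod_i M i (s i).
Proof.
rewrite -(det_ublock _ 0).
have ME i j : block_mx (ulsubmx M) 0 0 (drsubmx M) i j =
    if (i < p)%N == (j < p)%N then M i j else 0.
  by rewrite !mxE; case: splitP => i' Ei; rewrite mxE; case: splitP => j' Ej;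
    rewrite !mxE ?Ei ?Ej ?ltn_ord ?ltnNge ?leq_addr //=;
    congr (M _ _); apply/val_inj.
rewrite /determinant [LHS](bigID (fun s : 'S_(p + q) =>
  [forall i : 'I_(p + q), (i < p)%N == (s i < p)%N])) /=.
rewrite [X in _ + X]big1 ?addr0 => [|s /forallPn[i si]]; last first.
  by rewrite (bigD1 i) //= ME (negPf si) mul0r mulr0.
apply: eq_bigr => s /forallP ss; congr (_ * _).
by apply: eq_bigr => i _; rewrite ME ss.
Qed.

Section Laplace.
Variables (R : comNzRingType) (p q : nat) (d : 'I_(p + q)).
Implicit Types (A : 'M[R]_(p + q)) (I J K : {set 'I_(p + q)}).

(** Two sets are allowed: [J = K] gives a permutation, whereas [I] followed by the complement of [K]
    selects rows in the expansion below. *)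
Definition split_nth J K (i : nat) := nth d (enum J ++ enum (~: K)) i.

Lemma card_compl K : #|K| = p -> #|~: K| = q.
Proof. by move=> Kp; apply/eqP; rewrite -(eqn_add2l p) -{1}Kp cardsC card_ord. Qed.

Lemma split_nth_inj J : injective (fun i : 'I_(p + q) => split_nth J J i).
Proof.
move=> i j; rewrite /split_nth => /eqP; rewrite nth_uniq.
- by move/eqP/val_inj.
- by rewrite size_cat -!cardE cardsC card_ord.
- by rewrite size_cat -!cardE cardsC card_ord.
rewrite cat_uniq !enum_uniq andbT; apply/hasPn => x.
by rewrite !mem_enum inE.
Qed.

Definition split_perm J : 'S_(p + q) := perm (@split_nth_inj J).

Lemma split_perm_mem J i : #|J| = p -> (split_perm J i \in J) = (i < p)%N.
Proof.
move=> Jp; rewrite permE /split_nth nth_cat -cardE Jp; case: ltnP => ip.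
  by rewrite -mem_enum mem_nth // -cardE Jp.
apply/negbTE; rewrite -finset.in_setC -mem_enum mem_nth // -cardE card_compl //.
by rewrite ltn_subLR.
Qed.

(** [split_perm J] is increasing on each of the two blocks, so its inversions all join an element of
    [J] to one of the complement. *)
Lemma odd_split_perm J : #|J| = p -> odd_perm (split_perm J) =
  odd #|[set x : 'I_(p + q) * 'I_(p + q) |
          [&& x.1 \in J, x.2 \in ~: J & (x.2 < x.1)%N]]|.
Proof.
move=> Jp; rewrite odd_perm_inversions.
pose f (x : 'I_(p + q) * 'I_(p + q)) := (split_perm J x.1, split_perm J x.2).
have f_inj : injective f by move=> [a b] [a' b'] [] /perm_inj-> /perm_inj->.
rewrite -(card_imset _ f_inj); congr (odd _); apply: eq_card => x.
have mono (i j : 'I_(p + q)) : (i < p)%N = (j < p)%N -> (i < j)%N ->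
    (split_perm J i < split_perm J j)%N.
  move=> ijp ij; rewrite !permE /split_nth !nth_cat -cardE Jp -ijp.
  case: (ltnP i p) => ip; apply: nth_enum_ltn; rewrite ?Jp ?card_compl //.
    by rewrite ij -ijp.
  by have := ltn_ord j; lia.
rewrite inE finset.in_setC; apply/imsetP/and3P => [[[i j]] | [x1 x2 x12]].
  rewrite inE /= => /andP[ij sji] -> /=; rewrite !split_perm_mem // sji.
  have [ijp|ijp] := eqVneq (i < p)%N (j < p)%N.
    by have := mono _ _ ijp ij; lia.
  by split => //; lia.
exists ((split_perm J)^-1%g x.1, (split_perm J)^-1%g x.2); last first.
  by rewrite /f /= !permKV; case: (x).
rewrite inE /= !permKV x12 andbT.
move: x1 x2; rewrite -{1}[x.1](permKV (split_perm J)) -{1}[x.2](permKV (split_perm J)).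
by rewrite !split_perm_mem // -leqNgt; apply: leq_trans.
Qed.

(* Both sides are the determinant of the matrix made of the rows of A with index
   in I, then in ~: K; its expansion is grouped by the image J of the first p
   rows. *)
Lemma laplace_expansion A I K : #|I| = p -> #|K| = p ->
  \sum_(J : {set 'I_(p + q)} | #|J| == p)
     (-1) ^+ split_perm J * (submatrix_det d A I J * submatrix_det d A (~: K) (~: J))
  = if I == K then (-1) ^+ split_perm K * \det A else 0.
Proof.
move=> Ip Kp.
pose M : 'M[R]_(p + q) := \matrix_(i, j) A (split_nth I K i) j.
pose P := [set i : 'I_(p + q) | (i < p)%N].
have Pp : #|P| = p.
  rewrite -[RHS]card_ord -(card_imset _ (@lshift_inj p q)); apply: eq_card => i.
  rewrite inE; apply/idP/imsetP => [ip|[j _ ->]] //=.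
  by exists (Ordinal ip) => //; apply/val_inj.
transitivity (\det M).
  rewrite [RHS](partition_big (fun s : 'S_(p + q) => s @: P) (fun J => #|J| == p)) /=;
    last by move=> s _; rewrite card_imset ?Pp //; apply: perm_inj.
  apply: eq_bigr => J /eqP Jp; set e := split_perm J.
  (* After this change of variable, the permutations sending [P] onto [J] become those preserving
     the two blocks. *)
  rewrite [RHS](reindex_inj (mulIg e)) /=.
  pose Me := col_perm e M.
  have ulE : submatrix_det d A I J = \det (ulsubmx Me).
    rewrite /submatrix_det.
    rewrite (det_dim (fun a b => A (nth d (enum I) a) (nth d (enum J) b)) Ip).
    congr (\det _); apply/matrixP => a b; rewrite !mxE !permE /split_nth.
    by rewrite !nth_cat -!cardE Ip Jp /= !ltn_ord.
  have drE : submatrix_det d A (~: K) (~: J) = \det (drsubmx Me).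
    rewrite /submatrix_det.
    rewrite (det_dim (fun a b => A (nth d (enum (~: K)) a) (nth d (enum (~: J)) b))
      (card_compl Kp)).
    congr (\det _); apply/matrixP => a b; rewrite !mxE !permE /split_nth.
    by rewrite !nth_cat -!cardE Ip Jp /= !ltnNge !leq_addr /= !addKn.
  rewrite ulE drE det_blocks_sum mulr_sumr.
  apply: eq_big => [s|s _].
    apply/forallP/eqP => [ss|sPJ i].
      apply/eqP; rewrite eqEcard card_imset ?Pp ?Jp ?leqnn ?andbT; last exact: perm_inj.
      apply/fintype.subsetP => _ /imsetP[i + ->]; rewrite inE permM split_perm_mem //.
      by rewrite -(eqP (ss i)).
    rewrite -(split_perm_mem (s i) Jp) -/e -permM -sPJ mem_imset ?inE //.
    exact: perm_inj.
  rewrite odd_permM signr_addb mulrA [X in _ = X * _]mulrC.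
  by congr (_ * _); apply: eq_bigr => i _; rewrite permM !mxE.
have [IK|IK] := eqVneq I K.
  have -> : M = row_perm (split_perm I) A.
    by apply/matrixP => i j; rewrite !mxE permE /= IK.
  by rewrite row_permE det_mulmx det_perm -IK.
(* Here [I] meets the complement of [K], and the row of a common element occurs twice in [M]. *)
have /fintype.subsetPn[x xI xK] : ~~ (I \subset K).
  by move: IK; rewrite eqEcard Ip Kp leqnn andbT.
have xp : (index x (enum I) < p)%N by rewrite -[ltnRHS]Ip cardE index_mem mem_enum.
have xq : (index x (enum (~: K)) < q)%N.
  by rewrite -[ltnRHS](card_compl Kp) cardE index_mem mem_enum inE.
pose i1 := lshift q (Ordinal xp); pose i2 := rshift p (Ordinal xq).
apply: (@determinant_alternate _ _ _ i1 i2); first by rewrite eq_lrshift.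
move=> j; rewrite !mxE; congr (A _ _); rewrite /split_nth !nth_cat -cardE Ip /=.
by rewrite xp ltnNge leq_addr /= addKn !nth_index ?mem_enum ?inE.
Qed.

End Laplace.

(** The form [p + q] of the dimension is recovered from [#|I|] and [#|~: I|], and the sign of the
    permutation becomes a count of inversions. *)
Lemma laplace_subsets (R : comNzRingType) n (d : 'I_n) (A : 'M[R]_n)
    (I K : {set 'I_n}) :
  #|I| = #|K| ->
  let sign (J : {set 'I_n}) : R := (-1) ^+
    #|[set x : 'I_n * 'I_n | [&& x.1 \in J, x.2 \in ~: J & (x.2 < x.1)%N]]| in
  \sum_(J : {set 'I_n} | #|J| == #|K|)
     sign J * (submatrix_det d A I J * submatrix_det d A (~: K) (~: J))
  = if I == K then sign K * \det A else 0.
Proof.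
move=> IK sign; have [p Kp] : exists p, #|K| = p by exists #|K|.
rewrite Kp in IK *; have := cardsC I; rewrite card_ord IK; move: #|~: I| => q pq.
move: d A I K IK Kp @sign; rewrite -pq => d A I K Ip Kp sign.
rewrite -[sign K]signr_odd -(odd_split_perm d) // -laplace_expansion //.
by apply: eq_bigr => J /eqP Jp; rewrite (odd_split_perm d) // signr_odd.
Qed.

(* The determinant of [t A + (1 - t)] does not vanish on [0, 1]. *)
Lemma det_posdef (R : rcfType) n (A : 'M[R]_n) :
  (forall v : 'rV_n, v != 0 -> 0 < (v *m A *m v^T) 0 0) -> 0 < \det A.
Proof.
move=> A_pos; pose B t := t *: A + (1 - t) *: 1%:M.
pose P := \det ('X *: map_mx polyC A + (1 - 'X) *: 1%:M).
have PE t : P.[t] = \det (B t).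
  rewrite -horner_evalE -det_map_mx; congr (\det _); apply/matrixP => i j.
  by rewrite !mxE /= horner_evalE !hornerE hornerMn hornerC.
(* At a root some nonzero [v] satisfies [v *m B t = 0], yet [v *m B t *m v^T] is a convex
   combination of two positive numbers. *)
have P_neq0 t : 0 <= t <= 1 -> ~~ root P t.
  move=> /andP[t0 t1]; rewrite rootE PE -unitfE -unitmxE -row_free_unit.
  rewrite -kermx_eq0; apply/rowV0P => v /sub_kermxP vB.
  apply/eqP; apply: contraT => v0; have := A_pos v v0.
  have vv : 0 < (v *m v^T) 0 0.
    rewrite mxE lt_neqAle sumr_ge0 ?andbT => [|i _]; last by rewrite !mxE -expr2 sqr_ge0.
    apply: contra_neq v0 => /esym/eqP; rewrite psumr_eq0 => [/allP vi0|i _]; last first.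
      by rewrite !mxE -expr2 sqr_ge0.
    apply/rowP => i; have := vi0 i; rewrite mem_index_enum !mxE => /(_ isT).
    by rewrite mulf_eq0 orbb => /eqP.
  have : (v *m B t *m v^T) 0 0 = 0 by rewrite vB mul0mx mxE.
  rewrite /B mulmxDr mulmxDl -!scalemxAr -!scalemxAl mulmx1.
  rewrite [_ 0 0]mxE [X in X + _]mxE [X in _ + X]mxE.
  move: ((v *m v^T) 0 0) ((v *m A *m v^T) 0 0) vv => b a; nra.
rewrite ltNge; apply/negP => dA.
(* The intermediate value theorem asks for a nonpositive value at 0 and a nonnegative one at 1,
   hence [- P]. *)
have [|t t01] := @poly_ivt _ (- P) 0 1 ler01.
  rewrite !hornerN !PE /B subr0 subrr !scale0r !scale1r addr0 add0r det1.
  by rewrite oppr_le0 ler01 oppr_ge0.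
by rewrite rootN; apply/negP/P_neq0.
Qed.

Section GeneralFields.
Context (R : realType) (Om : spacetime R) (N : nat) (E : vector_bundle Om N)
  (h : bundle_metric E) (nabla : connection E) (K : kind).
Implicit Types (F G : gform E K).

(** * Flat and sharp on the values of forms *)

Lemma value_star_linear (H : 'M[R]_N) : linear (@value_star R N K H).
Proof.
case: K => //= c u v; rewrite /value_star /=.
by congr pair; rewrite /= ?linearD ?linearZ /= ?mulmxDr ?scalemxAr ?linearD ?linearZ.
Qed.

Lemma value_starK (H : 'M[R]_N) : H \in unitmx -> involutive (@value_star R N K H).
Proof.
move=> Hu v; rewrite /value_star; case: K v => //= -[u w] /=.
by rewrite trmxK mulKmx // mulKVmx // trmxK.
Qed.

Lemma value_starD (H : 'M[R]_N) u v :
  value_star H (u + v) = value_star H u + @value_star R N K H v.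
Proof. by have := value_star_linear H 1 u v; rewrite !scale1r. Qed.

Lemma value_star0 (H : 'M[R]_N) : value_star H 0 = 0 :> value R N K.
Proof. by apply: (addIr (value_star H 0)); rewrite -value_starD !add0r. Qed.

Lemma value_starZ (H : 'M[R]_N) b u :
  value_star H (b *: u) = b *: @value_star R N K H u.
Proof. by have := value_star_linear H b u 0; rewrite value_star0 !addr0. Qed.

Lemma value_star_sum (H : 'M[R]_N) (T : finType) (P : pred T) (c : T -> R) v :
  value_star H (\sum_(i | P i) c i *: v i) =
  \sum_(i | P i) c i *: @value_star R N K H (v i).
Proof.
rewrite (big_morph _ (value_starD H) (value_star0 H)).
by apply: eq_bigr => i _; rewrite value_starZ.
Qed.

(** * The metric determinant and the double Hodge star *)

Lemma region_space k x : @region _ _ _ E k x ->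
  exists2 p : Defs.space Om, cdom (fchart k) p & space_part x = ccoord (fchart k) p.
Proof.
case=> p kp <-; exists p.2; first by case: (fdom_sub kp).
by rewrite /space_part /coords row_mxKr.
Qed.

(** The time block contributes the factor -1, the positive definite space block a positive one. *)
Lemma metric4_det k x : @region _ _ _ E k x -> \det (metric4 (fchart k) x) < 0.
Proof.
move=> /region_space[p cp xp]; rewrite /metric4 (@det_ublock _ 1 3).
rewrite -scalemx1 -scaleNr detZ det1 mulr1 expr1 mulN1r oppr_lt0.
by apply: det_posdef; apply: gs_pos; rewrite xp; exists p.
Qed.

Lemma metric4_sym k x : @region _ _ _ E k x ->
  (metric4 (fchart k) x)^T = metric4 (fchart k) x.
Proof.
move=> /region_space[p cp xp]; apply: etrans (@tr_block_mx _ 1 3 1 3 _ _ _ _) _.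
rewrite !trmx0 linearN /= trmx1 gs_sym //; by rewrite xp; exists p.
Qed.

Lemma minor_tr (A : 'M[R]_4) (I J : {set 'I_4}) : #|I| = #|J| ->
  minor A^T I J = minor A J I.
Proof.
move=> IJ; rewrite /minor.
rewrite (det_dim (fun a b => A^T (nth ord0 (enum I) a) (nth ord0 (enum J) b)) IJ).
by rewrite -det_tr; congr (\det _); apply/matrixP => a b; rewrite !mxE.
Qed.

(* The set in [wsign] is a classical set. *)
Lemma wsignE (I J : {set 'I_4}) : wsign R I J = (-1) ^+
  #|[set x : 'I_4 * 'I_4 | [&& x.1 \in I, x.2 \in J & (x.2 < x.1)%N]]%SET|.
Proof.
congr (_ ^+ _); apply: eq_card => x; rewrite [RHS]inE.
by apply/idP/idP; rewrite in_setE.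
Qed.

(** Each pair of an element of [I] and one of its complement is counted in exactly one of the two
    signs; the total p(4 - p) has the parity of p. *)
Lemma wsign_swap (I : {set 'I_4}) :
  wsign R (~: I) I * wsign R I (~: I) = (-1) ^+ #|I|.
Proof.
pose inv (S T : {set 'I_4}) :=
  [set x : 'I_4 * 'I_4 | [&& x.1 \in S, x.2 \in T & (x.2 < x.1)%N]]%SET.
pose A := inv (~: I) I; pose B := inv I (~: I).
rewrite !wsignE -/(inv _ _) -/(inv _ _) -/A -/B -exprD.
pose swap (x : 'I_4 * 'I_4) := (x.2, x.1).
have swapK : involutive swap by case.
pose C := [set x : 'I_4 * 'I_4 | (x.2 < x.1)%N]%SET.
have -> : (#|A| + #|B| = #|I| * #|~: I|)%N.
  rewrite -cardsX -(cardsID C (finset.setX I (~: I))) [RHS]addnC.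
  rewrite -(card_preimset A (inv_inj swapK)).
  congr addn; apply: eq_card => -[i j]; rewrite !inE /=; last by rewrite andbA.
  case: (ltngtP i j) => [||/val_inj->]; rewrite ?andbF ?andbT //= 1?andbC //.
  by case: (j \in I).
have := cardsC I; rewrite card_ord; move: #|I| #|~: I| => p q pq.
have [-> p4] : q = (4 - p)%N /\ (p <= 4)%N by lia.
by rewrite -[LHS]signr_odd -[RHS]signr_odd oddM oddB //= andbb.
Qed.

Lemma laplace_wsign (A : 'M[R]_4) (L I : {set 'I_4}) : #|L| = #|I| ->
  \sum_(J : {set 'I_4} | #|J| == #|I|)
     wsign R J (~: J) * (minor A L J * minor A (~: I) (~: J)) =
  if L == I then wsign R I (~: I) * \det A else 0.
Proof.
move=> LI; rewrite wsignE -(laplace_subsets ord0 A LI).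
by apply: eq_bigr => J _; rewrite wsignE.
Qed.

Lemma star_star F k x I : region k x ->
  star h (star h F) k x I = (-1) ^+ #|I|.+1 *: F k x I.
Proof.
move=> kx; rewrite /star; set g := metric4 _ x; set s := Num.sqrt _.
have g_sym : (invmx g)^T = invmx g by rewrite trmx_inv metric4_sym.
have cardsC_eq (J L : {set 'I_4}) : (#|~: J| == #|~: L|) = (#|J| == #|L|).
  by have := cardsC J; have := cardsC L; lia.
rewrite value_star_sum scaler_sumr (reindex_inj (@finset.setC_inj 'I_4)) /=.
transitivity (\sum_(J : {set 'I_4} | #|J| == #|I|)
    \sum_(L : {set 'I_4} | #|L| == #|I|)
    (s * s * wsign R (~: I) I *
     (wsign R J (~: J) * (minor (invmx g) L J * minor (invmx g) (~: I) (~: J))))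
     *: F k x L).
  apply: eq_big => [J|J]; first exact: cardsC_eq.
  rewrite cardsC_eq => /eqP JI; rewrite value_starZ value_starK ?bm_nondegenerate //.
  rewrite !finset.setCK !scaler_sumr JI; apply: eq_bigr => L _.
  rewrite -(@minor_tr _ (~: J)) ?g_sym; last by apply/eqP; rewrite cardsC_eq JI.
  by rewrite !scalerA; congr (_ *: _); ring.
(* With the sum over [J] taken first, the Laplace expansion leaves only [L = I]. *)
rewrite exchange_big /=.
under eq_bigr => L /eqP LI do rewrite -scaler_suml -mulr_sumr laplace_wsign //.
rewrite (bigD1 I) //= eqxx [X in _ + X]big1 ?addr0 => [|L /andP[_ /negPf->]]; last first.
  by rewrite mulr0 scale0r.
(* As s^2 = |det g| = - det g, the product with det g^-1 is -1, which turns the exponent [#|I|] into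
   [#|I|.+1]. *)
congr (_ *: _); rewrite mulrA -[s * s * _ * _]mulrA wsign_swap det_inv.
rewrite -expr2 sqr_sqrtr ?normr_ge0 // ltr0_norm ?metric4_det // exprS.
by have := metric4_det kx; rewrite -/g; move: (\det g) => d d0; field; rewrite ltr0_neq0.
Qed.

(** * Block structure of the metric and support of the Hodge star *)

Lemma metric4_time (c : chart (Defs.space Om)) x j : j != ord0 ->
  metric4 c x ord0 j = 0 /\ metric4 c x j ord0 = 0.
Proof.
rewrite /metric4; have -> : ord0 = lshift 3 (0 : 'I_1) :> 'I_4 by apply/val_inj.
case: (@split_ordP 1 3 j) => l -> /=; first by rewrite ord1 eqxx.
by rewrite (@block_mxEur _ 1 3 1 3) (@block_mxEdl _ 1 3 1 3) !mxE.
Qed.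

Lemma metric4_00 (c : chart (Defs.space Om)) x : metric4 c x ord0 ord0 = -1.
Proof.
rewrite /metric4; have -> : ord0 = lshift 3 (0 : 'I_1) :> 'I_4 by apply/val_inj.
by rewrite (@block_mxEul _ 1 3 1 3) !mxE.
Qed.

(* Outside the chart [metric4] may be singular, in which case [invmx] is the
   identity function. *)
Lemma inv_metric4_time (c : chart (Defs.space Om)) x j : j != ord0 ->
  invmx (metric4 c x) ord0 j = 0 /\ invmx (metric4 c x) j ord0 = 0.
Proof.
move=> j0; have [gu|gu] := boolP (metric4 c x \in unitmx); last first.
  by rewrite invmx_out //; apply: metric4_time.
have /matrixP gB := mulmxV gu; have /matrixP Bg := mulVmx gu; split.
  (* Row 0 of the metric is -1 followed by zeros, so this entry of the product is minus that of the
     inverse. *)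
  have := gB ord0 j; rewrite !mxE (bigD1 ord0) //= big1 => [|i i0].
    by rewrite metric4_00 eq_sym (negPf j0) addr0 mulN1r => /eqP; rewrite oppr_eq0 => /eqP.
  by rewrite (metric4_time c x i0).1 mul0r.
have := Bg j ord0; rewrite !mxE (bigD1 ord0) //= big1 => [|i i0].
  by rewrite metric4_00 (negPf j0) addr0 mulrN1 => /eqP; rewrite oppr_eq0 => /eqP.
by rewrite (metric4_time c x i0).2 mulr0.
Qed.

Lemma minor_row_eq0 (A : 'M[R]_4) (i : 'I_4) (I J : {set 'I_4}) : #|I| = #|J| ->
  i \in I -> {in J, forall j, A i j = 0} -> minor A I J = 0.
Proof.
move=> IJ iI AiJ; rewrite /minor; set M := \matrix_(_, _) _.
have iltI : (index i (enum I) < #|I|)%N by rewrite cardE index_mem mem_enum.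
rewrite (expand_det_row M (Ordinal iltI)) big1 // => b _.
rewrite !mxE nth_index ?mem_enum // AiJ ?mul0r //.
by rewrite -mem_enum mem_nth // -cardE -IJ.
Qed.

(** Exactly one of the two sets contains 0, so the submatrix has a zero row or a zero column. *)
Lemma minor_inv_metric4 (c : chart (Defs.space Om)) x (I J : {set 'I_4}) :
  #|I| = #|J| -> (ord0 \in I) != (ord0 \in J) ->
  minor (invmx (metric4 c x)) I J = 0.
Proof.
move=> IJ; have [I0|I0] := boolP (ord0 \in I); have [J0|J0] := boolP (ord0 \in J) => // _.
  apply: (minor_row_eq0 IJ I0) => j jJ; apply: (inv_metric4_time c x _).1.
  by apply: contraNneq J0 => <-.
rewrite -minor_tr //; apply: (minor_row_eq0 (esym IJ) J0) => i iI; rewrite mxE.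
by apply: (inv_metric4_time c x _).2; apply: contraNneq I0 => <-.
Qed.

Lemma star_ext F G k x (J : {set 'I_4}) :
  (forall I : {set 'I_4}, #|I| = #|~: J| -> (ord0 \in I) = (ord0 \notin J) ->
     F k x I = G k x I) ->
  star h F k x J = star h G k x J.
Proof.
move=> FG; rewrite /star; congr (_ *: value_star _ _); apply: eq_bigr => I /eqP IJ.
have [I0|I0] := eqVneq (ord0 \in I) (ord0 \in (~: J)%SET).
  by rewrite FG // I0 finset.in_setC.
by rewrite minor_inv_metric4 // !scale0r.
Qed.

Lemma star0 : star h 0 = 0 :> gform E K.
Proof.
apply/funext => k; apply/funext => x; apply/funext => J.
by rewrite /star big1 ?value_star0 ?scaler0 // => I _; rewrite scaler0.
Qed.

Lemma starD F G : star h (F + G) = star h F + star h G.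
Proof.
apply/funext => k; apply/funext => x; apply/funext => J.
rewrite /star !fctE -scalerDr -value_starD -big_split /=.
by congr (_ *: value_star _ _); apply: eq_bigr => I _; rewrite scalerDr.
Qed.

(** * Splitting by degree and by the presence of dt *)

Lemma value_conn0 (A : 'M[R]_N) : value_conn A 0 = 0 :> value R N K.
Proof.
case: K => //=; last by rewrite mulmx0 mul0mx subrr.
by rewrite mulmx0 mul0mx oppr0.
Qed.

(** [b] records a factor dt, so time-like and space-like components are treated at once. *)
Definition bidegree (a : nat) (b : bool) F : gform E K :=
  fun k x I => if (#|I| == a) && ((ord0 \in I) == b) then F k x I else 0.

(** The mask depends on the index set and not on the point, so it passes through differentiation. *)
Lemma dwedge_bidegree i a b F k x (I : {set 'I_4}) :
  dwedge nabla i (bidegree a b F) k x I =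
  if (#|I| == a.+1) && ((ord0 \in (I :\ i)%SET) == b) then dwedge nabla i F k x I
  else 0.
Proof.
rewrite /dwedge /bidegree; have [iI|_] := boolP (i \in I); last by case: ifP.
have -> : (#|I| == a.+1) = (#|(I :\ i)%SET| == a) by rewrite (cardsD1 i I) iI.
by case: ifP => // _; rewrite derive_cst add0r value_conn0 scaler0.
Qed.

Lemma dtime_eq0 F k x (I : {set 'I_4}) : ord0 \notin I -> dtime nabla F k x I = 0.
Proof. by rewrite /dtime /dwedge => /negPf->. Qed.

Lemma dtime_bidegree a F :
  dtime nabla (bidegree a false F) = bidegree a.+1 true (dtime nabla F).
Proof.
apply/funext => k; apply/funext => x; apply/funext => I.
rewrite /bidegree /dtime dwedge_bidegree !inE eqxx /= andbT.
have [I0|I0] := boolP (ord0 \in I); first by rewrite andbT.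
by rewrite andbF /dwedge (negPf I0); case: ifP.
Qed.

Lemma dspaceE F k x (I : {set 'I_4}) :
  dspace nabla F k x I = \sum_(i < 4 | i != ord0) dwedge nabla i F k x I.
Proof. by rewrite /dspace !fct_sumE. Qed.

Lemma dspace_bidegree a b F :
  dspace nabla (bidegree a b F) = bidegree a.+1 b (dspace nabla F).
Proof.
apply/funext => k; apply/funext => x; apply/funext => I; rewrite /bidegree !dspaceE.
case: ifP => Iab; [apply: eq_bigr => i i0|apply: big1 => i i0];
  by rewrite dwedge_bidegree !inE [ord0 == i]eq_sym (negPf i0) Iab.
Qed.

(** With the boolean read as 0 or 1, the bound says that [I] contains no space index. *)
Lemma dspace_eq0 F k x (I : {set 'I_4}) :
  (#|I| <= (ord0 \in I))%N -> dspace nabla F k x I = 0.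
Proof.
move=> I1; rewrite dspaceE big1 // => i i0; rewrite /dwedge ifN //.
apply: contraL I1 => iI; rewrite -ltnNge (cardsD1 ord0 I) -addn1 leq_add2l.
by rewrite card_gt0; apply/set0Pn; exists i; rewrite !inE i0.
Qed.

Lemma star_bidegree a a' b F : (a + a')%N = 4%N ->
  star h (bidegree a b F) = bidegree a' (~~ b) (star h F).
Proof.
move=> aa'; apply/funext => k; apply/funext => x; apply/funext => J.
rewrite {2}/bidegree; case: ifPn => Jab.
  apply: star_ext => I; rewrite /bidegree => IJ I0; rewrite ifT //.
  have := cardsC J; rewrite card_ord; move: Jab; rewrite I0 IJ.
  by case: b (_ \in J) => -[] //=; lia.
transitivity (star h (0 : gform E K) k x J); last by rewrite star0.
apply: star_ext => I; rewrite /bidegree => IJ I0; rewrite ifN //.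
apply: contra Jab; have := cardsC J; rewrite card_ord I0 IJ.
by case: b (_ \in J) => -[] //=; lia.
Qed.

Lemma tpart_deg a F : tpart (deg a F) = bidegree a true F.
Proof.
apply/funext => k; apply/funext => x; apply/funext => I; rewrite /tpart /deg /bidegree.
by case: (ord0 \in I); rewrite ?andbT ?andbF.
Qed.

Lemma spart_deg a F : spart (deg a F) = bidegree a false F.
Proof.
apply/funext => k; apply/funext => x; apply/funext => I; rewrite /spart /deg /bidegree.
by case: (ord0 \in I); rewrite ?andbT ?andbF.
Qed.

Lemma deg0 F : deg 0 F = bidegree 0 false F.
Proof.
apply/funext => k; apply/funext => x; apply/funext => I; rewrite /deg /bidegree.
have [/eqP|//] := eqVneq #|I| 0%N.
by rewrite cards_eq0 => /eqP->; rewrite finset.in_set0.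
Qed.

(** With [codspace], the time-like and space-like parts of the codifferential, up to sign. *)
Definition codtime F := star h (dtime nabla (star h F)).
Definition codspace F := star h (dspace nabla (star h F)).

(** The degree runs through a, 4 - a, 5 - a, a - 1, while the factor dt is removed, restored and
    removed again. *)
Lemma codtime_bidegree a F : (0 < a <= 4)%N ->
  codtime (bidegree a true F) = bidegree a.-1 false (codtime F).
Proof.
case: a => // a a4; rewrite /codtime (@star_bidegree _ (4 - a.+1)) ?subnKC //=.
by rewrite dtime_bidegree (@star_bidegree _ a) //; move: a4; lia.
Qed.

Lemma codspace_bidegree a b F : (0 < a <= 4)%N ->
  codspace (bidegree a b F) = bidegree a.-1 b (codspace F).
Proof.
case: a => // a a4; rewrite /codspace (@star_bidegree _ (4 - a.+1)) ?subnKC //=.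
by rewrite dspace_bidegree (@star_bidegree _ a) ?negbK //; move: a4; lia.
Qed.

Lemma codtime_eq0 F k x (I : {set 'I_4}) : ord0 \in I -> codtime F k x I = 0.
Proof.
move=> I0; transitivity (star h (0 : gform E K) k x I); last by rewrite star0.
by apply: star_ext => J _; rewrite I0 => /negbT/dtime_eq0.
Qed.

(** The bound says that [I] contains all three space indices, so the index sets read by the outer
    star contain none. *)
Lemma codspace_eq0 F k x (I : {set 'I_4}) :
  (4 <= #|I| + (ord0 \notin I))%N -> codspace F k x I = 0.
Proof.
move=> I4; transitivity (star h (0 : gform E K) k x I); last by rewrite star0.
apply: star_ext => J JI J0; apply: dspace_eq0; rewrite JI J0.
by have := cardsC I; rewrite card_ord; lia.
Qed.

(** * The rows of the system *)

Lemma dcovE F : dcov nabla F = dtime nabla F + dspace nabla F.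
Proof. by rewrite /dcov (bigD1 ord0). Qed.

Lemma codcovE F : star h (dcov nabla (star h F)) = codtime F + codspace F.
Proof. by rewrite dcovE starD. Qed.

(** The bidegree of the source in each row. *)
Definition row_index (i : 'I_8) : nat * bool :=
  nth (0%N, false) [:: (4, true); (3, false); (2, true); (1, false);
                      (3, true); (2, false); (1, true); (0, false)] i.

Lemma row_index_cover (I : {set 'I_4}) : exists i, row_index i = (#|I|, ord0 \in I).
Proof.
(* There are three space indices, so the degree lies between 0 and 3, shifted by one if dt
   occurs. *)
have : ((ord0 \in I) <= #|I| <= 3 + (ord0 \in I))%N.
  have := cardsC I; rewrite card_ord (cardsD1 ord0 I) (cardsD1 ord0 (~: I)) finset.in_setC.
  by case: (_ \in I); lia.
case: #|I| (ord0 \in I) => [|[|[|[|[|p]]]]] [] //= _.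
- by exists (inord 7); rewrite /row_index inordK.
- by exists (inord 6); rewrite /row_index inordK.
- by exists (inord 3); rewrite /row_index inordK.
- by exists (inord 2); rewrite /row_index inordK.
- by exists (inord 5); rewrite /row_index inordK.
- by exists (inord 4); rewrite /row_index inordK.
- by exists (inord 1); rewrite /row_index inordK.
- by exists (inord 0); rewrite /row_index inordK.
Qed.

(** The sign is that of the double star on forms of degree [#|I|]. *)
Definition balance F : gform E K := fun k x I =>
  dcov nabla F k x I + (-1) ^+ #|I|.+1 *: star h (dcov nabla (star h F)) k x I.

Lemma system_row F (i : 'I_8) :
  \sum_(j < 8) (nth id (nth [::] (system_matrix h nabla K) i) j) (nth 0 (unknowns F) j)
  = bidegree (row_index i).1 (row_index i).2 (balance F).
Proof.
rewrite /unknowns !tpart_deg !spart_deg deg0.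
apply/funext => k; apply/funext => x; apply/funext => I.
rewrite [RHS]/bidegree /balance dcovE codcovE !fctE.
case: i => -[|[|[|[|[|[|[|[|//]]]]]]]] /= ilt8;
  rewrite /row_index !big_ord_recl big_ord0 /=.
all: rewrite !(add0r, addr0) -?/(codtime _) -?/(codspace _).
all: rewrite ?dtime_bidegree ?dspace_bidegree ?codtime_bidegree.
all: rewrite ?codspace_bidegree // /bidegree !fctE /=.
all: case: ifP => [/andP[/eqP Ip /eqP I0]|_]; last by rewrite ?oppr0 ?addr0.
(* These four facts remove the terms of [balance] that have no entry in the row. *)
all: have T0 : ord0 \notin I -> dtime nabla F k x I = 0 by apply: dtime_eq0.
all: have D0 : (#|I| <= (ord0 \in I))%N -> dspace nabla F k x I = 0
  by apply: dspace_eq0.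
all: have cT0 : ord0 \in I -> codtime F k x I = 0 by apply: codtime_eq0.
all: have cD0 : (4 <= #|I| + (ord0 \notin I))%N -> codspace F k x I = 0
  by apply: codspace_eq0.
all: rewrite Ip I0 /= in T0 D0 cT0 cD0 *.
(* The parity of the degree fixes the sign: even degrees give the negated entries of the matrix. *)
all: rewrite -signr_odd /= ?expr0 ?expr1 ?scale1r ?scaleN1r ?opprD.
- by rewrite cT0 // cD0 // subr0 oppr0 addr0.
- by rewrite T0 // cD0 // add0r addr0 addrC.
- by rewrite cT0 // oppr0 add0r [- _ + _]addrC addrA.
- by rewrite T0 // add0r addrA addrC.
- by rewrite cT0 // add0r [LHS]addrC [X in X + _]addrC.
- by rewrite T0 // add0r [LHS]addrC -addrA.
- by rewrite cT0 // D0 // addr0 add0r addrC.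
- by rewrite T0 // D0 // !add0r addrC.
Qed.

(** Every index set has the bidegree of some row, so the masked equations together give the whole
    one. *)
Lemma matrix_systemP F G : matrix_system h nabla F G <-> form_eq (balance F) G.
Proof.
have sourceE (i : 'I_8) k x I : nth 0 (sources G) i k x I =
    bidegree (row_index i).1 (row_index i).2 G k x I.
  rewrite /sources !tpart_deg !spart_deg deg0.
  by case: i => -[|[|[|[|[|[|[|[|//]]]]]]]].
split=> [FG k x kx I|FG i k x kx I].
  have [i iI] := row_index_cover I; have := FG i k x kx I.
  by rewrite system_row sourceE iI /bidegree !eqxx.
by rewrite system_row sourceE /bidegree; case: ifP => // _; apply: FG.
Qed.

(** In degree p, multiplication by (-1)^(p+1), which is its own inverse, passes from either equation
    to the other. *)
Lemma codifferential_balance F G : form_eq (dcov nabla F) 0 ->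
  form_eq (star h (dcov nabla (star h F))) (star h (star h G)) <-> form_eq (balance F) G.
Proof.
move=> dF; split=> FG k x kx I; have := FG k x kx I.
  by rewrite /balance dF // add0r => ->; rewrite star_star // scalerA -expr2 sqrr_sign scale1r.
by rewrite /balance dF // add0r star_star // => <-; rewrite scalerA -expr2 sqrr_sign scale1r.
Qed.

End GeneralFields.

Theorem theorem3p12 (R : realType) (Om : spacetime R) (N : nat)
    (E : vector_bundle Om N) (h : bundle_metric E) (nabla : connection E)
    (K : kind) (F G : gform E K)
    (hF : general_field F) (hG : general_field G) :
  conservation_law h nabla F G <->
  form_eq (dcov nabla F) 0%R /\ matrix_system h nabla F G.
Proof.
rewrite /conservation_law matrix_systemP.
split=> -[dF FG]; split=> //.
  exact/(@codifferential_balance _ _ _ _ h nabla K F G dF).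
exact/(@codifferential_balance _ _ _ _ h nabla K F G dF).
Qed.
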